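(* Let $k\ge 1$ and $q\ge 1$ be integers, and suppose that the complete multipartite graph $K_{k\times q}$ (with $q$ parts, each of size $k$) can be partitioned into edge-disjoint copies of the complete graph $K_{k+1}$ (i.e. a $(k+1)$-GDD of type $k^q$ exists). Then, with $N=2kq+1$ and $C=\frac{k(k+1)}{2}$, there is a valid partition of the request tournament $T_N$ of cost $\frac{N(N-1)}{2k}$, and this is optimal: $A\!\left(\frac{k(k+1)}{2},\,2kq+1\right)=\frac{N(N-1)}{2k}$.
   Context: Fix integers $N\ge 2$ and $C\ge 1$ (the grooming factor). Let $\vec C_N$ be the directed cycle on vertices $0,1,\dots,N-1$ with arcs $(i,i+1 \bmod N)$. For distinct vertices $u,v$ let $d(u,v)=(v-u)\bmod N$ be the length of the directed path from $u$ to $v$ in $\vec C_N$. A request tournament $T_N$ is a tournament on $\{0,\dots,N-1\}$ containing every arc $(u,v)$ with $d(u,v)<N/2$ and, when $N$ is even, exactly one of the two arcs $(i,i+N/2)$, $(i+N/2,i)$ for each $0\le i<N/2$ (for $N$ odd, $T_N$ is unique). Each arc $(u,v)$ of $T_N$ is routed along the directed path from $u$ to $v$ in $\vec C_N$. For a subdigraph $B$ of $T_N$ and an arc $e$ of $\vec C_N$, the load $L(B,e)$ is the number of arcs of $B$ whose route contains $e$; $B$ is admissible if $L(B,e)\le C$ for every arc $e$. A valid partition is a partition of the arc set of $T_N$ into admissible subdigraphs $B_1,\dots,B_W$, where $V(B_\omega)$ is the set of endpoints of arcs of $B_\omega$; its cost is $\sum_\omega |V(B_\omega)|$. $A(C,N)$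 denotes the minimum cost of a valid partition over all choices of $T_N$ and all valid partitions. *)

(* Defs.v *)
From mathcomp Require Import all_boot zify.

Set Implicit Arguments.
Unset Strict Implicit.
Unset Printing Implicit Defensive.

Notation darc N := ('I_N * 'I_N)%type.

Definition dicycle (N : nat) : {set darc N} :=
  [set (i, ordS i) | i : 'I_N].

(* (v - u) mod N; N is added first because subtraction on nat truncates. *)
Definition dist (N : nat) (u v : 'I_N) : nat := (v + N - u) %% N.

(* The arcs of the directed path from u to v in the dicycle. *)
Definition route (N : nat) (u v : 'I_N) : {set darc N} :=
  [set (iter j (@ordS N) u, iter j.+1 (@ordS N) u) | j : 'I_N & j < dist u v].

Definition tournament (N : nat) (T : {set darc N}) : bool :=
  [forall u, (u, u) \notin T] &&
  [forall u, forall v, (u != v) ==> ((u, v) \in T) (+) ((v, u) \in T)].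

(* For N even, a tournament automatically contains exactly one of the two arcs
   joining i and i + N/2, and either choice is allowed. *)
Definition request_tournament (N : nat) (T : {set darc N}) : bool :=
  tournament T &&
  [forall u, forall v, (u != v) && (2 * dist u v < N) ==> ((u, v) \in T)].

Definition load (N : nat) (B : {set darc N}) (e : darc N) : nat :=
  #|[set a in B | e \in route a.1 a.2]|.

Definition admissible (C N : nat) (B : {set darc N}) : bool :=
  [forall e in dicycle N, load B e <= C].

Definition valid_partition (C N : nat) (T : {set darc N})
    (P : {set {set darc N}}) : bool :=
  partition P T && [forall B in P, admissible C B].

Definition vertices (N : nat) (B : {set darc N}) : {set 'I_N} :=
  [set a.1 | a in B] :|: [set a.2 | a in B].

Definition cost (N : nat) (P : {set {set darc N}}) : nat :=
  \sum_(B in P) #|vertices B|.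

(* A feasible solution, needed only to seed the minimum below. *)
Definition default_tournament (N : nat) : {set darc N} :=
  [set a | (a.1 != a.2) && ((2 * dist a.1 a.2 < N) ||
                            (2 * dist a.1 a.2 == N) && (a.1 < a.2))].

Definition singletons (N : nat) (T : {set darc N}) : {set {set darc N}} :=
  [set [set a] | a in T].

(* The minimum of the cost over all pairs (T, P) of a request tournament and a
   valid partition of it; see min_costP. *)
Definition min_cost (C N : nat) : nat :=
  cost [arg min_(TP < (default_tournament N, singletons (default_tournament N))
                 | request_tournament TP.1 && valid_partition C TP.1 TP.2)
          cost TP.2].2.

Lemma distE (N : nat) (u v : 'I_N) :
  dist u v = if u <= v then v - u else v + N - u.
Proof.
rewrite /dist; have := ltn_ord u; have := ltn_ord v.
case: (leqP u v) => uv vN uN; last by rewrite modn_small //; lia.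
by rewrite addnC -addnBA // modnDl modn_small //;
  apply: leq_ltn_trans vN; exact: leq_subr.
Qed.

Lemma default_tournamentP (N : nat) :
  request_tournament (default_tournament N).
Proof.
apply/andP; split; last first.
  apply/forallP => u; apply/forallP => v; apply/implyP => /andP[uv d].
  by rewrite inE /= uv d.
apply/andP; split; first by apply/forallP => u; rewrite inE /= eqxx.
apply/forallP => u; apply/forallP => v; apply/implyP => uv.
rewrite !inE /= (eq_sym v u) uv /= !distE.
have := ltn_ord u; have := ltn_ord v; move: uv; rewrite -val_eqE /=.
move: (nat_of_ord u) (nat_of_ord v) => m n.
case: (ltngtP m n) => //= mn _ nN mN; rewrite ?andbF ?orbF ?andbT.
  by case: (ltngtP (2 * (n - m)) N); case: (ltngtP (2 * (m + N - n)) N); lia.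
by case: (ltngtP (2 * (m - n)) N); case: (ltngtP (2 * (n + N - m)) N); lia.
Qed.

Lemma request_tournament_uniq (N : nat) (T T' : {set darc N}) :
  odd N -> request_tournament T -> request_tournament T' -> T = T'.
Proof.
move=> oN.
suff H (S : {set darc N}) : request_tournament S -> S = default_tournament N.
  by move=> /H-> /H->.
case/andP => /andP[/forallP Sl /forallP Sx] /forallP Sd.
apply/setP => -[u v]; rewrite inE /=.
have [->|uv] := eqVneq u v; first exact/negbTE.
have := forallP (Sd u) v; rewrite uv /=.
have := forallP (Sd v) u; rewrite (eq_sym v u) uv /=.
have := forallP (Sx u) v; rewrite uv /= !distE.
have := ltn_ord u; have := ltn_ord v; move: uv; rewrite -val_eqE /=.
move: (nat_of_ord u) (nat_of_ord v) ((u, v) \in S) ((v, u) \in S) => m n [] [] //=;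
  rewrite ?implybT ?implybF; case: (ltngtP m n) => //=; lia.
Qed.

Lemma singletonsP (C N : nat) (T : {set darc N}) :
  0 < C -> valid_partition C T (singletons T).
Proof.
move=> C0; apply/andP; split.
  apply/and3P; split.
  - apply/eqP/setP => a; apply/bigcupP/idP => [[B /imsetP[b bT ->]]|aT].
      by rewrite inE => /eqP ->.
    by exists [set a]; rewrite ?inE //; apply: imset_f.
  - apply/trivIsetP => _ _ /imsetP[a _ ->] /imsetP[b _ ->] ab.
    by rewrite disjoints1 inE; apply: contraNneq ab => ->.
  - by apply/imsetP => -[a _ /setP/(_ a)]; rewrite !inE eqxx.
apply/forall_inP => _ /imsetP[a _ ->]; apply/forall_inP => e _.
apply: leq_trans C0; rewrite -(cards1 a); apply: subset_leq_card.
by apply/subsetP => b; rewrite inE => /andP[].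
Qed.

Lemma min_costP (C N : nat) : 0 < C ->
  (exists T P, [/\ @request_tournament N T, valid_partition C T P &
                   cost P = min_cost C N]) /\
  (forall T P, @request_tournament N T -> valid_partition C T P ->
     min_cost C N <= cost P).
Proof.
move=> C0; rewrite /min_cost; case: arg_minnP => [|[T P] /= /andP[rT vP] le].
  by rewrite /= default_tournamentP singletonsP.
split; first by exists T, P.
by move=> T' P' rT' vP'; apply: (le (T', P')); rewrite /= rT' vP'.
Qed.

Definition complete_graph (V : finType) (S : {set V}) : {set {set V}} :=
  [set e : {set V} | (e \subset S) && (#|e| == 2)].

(* K_{k x q}: the vertex (i, x) lies in part i, so there are q parts of size k. *)
Definition complete_multipartite (k q : nat) : {set {set 'I_q * 'I_k}} :=
  [set e : {set 'I_q * 'I_k} |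
    [exists x, exists y, (x.1 != y.1) && (e == [set x; y])]].

Definition clique_decomposable (m : nat) (V : finType) (E : {set {set V}}) :
    Prop :=
  exists2 X : {set {set V}}, forall S, S \in X -> #|S| = m &
    partition [set complete_graph S | S in X] E.

(* Main.v *)
(* Lower bound: cut the cycle at the vertices of an admissible B and let l(a) be
   the number of pieces covered by the route of the arc a.  The arcs leaving a
   given vertex have distinct positive l(a), while the sum of l(a) over B is the
   sum of the loads just after the vertices, at most |V(B)| C; hence
   |B| <= k |V(B)|, and the cost is at least |T_N| / k.

   Upper bound: double the points of the GDD into antipodal vertices and add one
   vertex at infinity.  Each block yields the arcs of T_N between lifts of
   distinct points of the block, and each group those between infinity and the
   lifts of the group.  In each of these digraphs every vertex has out-degree k
   and its out-neighbours are the next k vertices (up to its own antipode), so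
   the load is at most 1 + ... + k = C and |B| = k |V(B)|. *)
Require Import Defs.
From mathcomp Require Import all_boot zify.

Set Implicit Arguments.
Unset Strict Implicit.
Unset Printing Implicit Defensive.

(** * Counting inequalities *)

Lemma sum_bool_card (I : finType) (A : {set I}) (p : pred I) :
  \sum_(x in A) p x = #|[set x in A | p x]|.
Proof.
rewrite -[RHS]sum1_card big_mkcond [RHS]big_mkcond; apply: eq_bigr => x _.
by rewrite !inE; case: (x \in A); case: (p x).
Qed.

(** The summands are the ranks of the elements of [A] under [f]: of two distinct elements, exactly
    one lies below the other. *)
Lemma sum_card_lt (I : finType) (A : {set I}) (f : I -> nat) :
  {in A &, injective f} ->
  2 * (\sum_(x in A) #|[set y in A | f y < f x]|) + #|A| = #|A| ^ 2.
Proof.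
move=> f_inj.
rewrite -mulnn -sum_nat_const mul2n -addnn.
under eq_bigr => x _ do rewrite -(sum_bool_card A (fun y => f y < f x)).
rewrite {1}exchange_big /= -big_split /= -[X in _ + X = _]sum1_card -big_split /=.
apply: eq_bigr => x xA.
rewrite -[RHS]sum1_card -big_split /= (bigD1 x) // [in RHS](bigD1 x) //=.
rewrite ltnn add0n addnC; congr (_ + _).
apply: eq_bigr => y /andP[yA yx]; case: ltngtP => // /f_inj fxy.
by rewrite fxy ?eqxx // in yx.
Qed.

(* The difference of the two sides is [(k - m) * (k - m + 1)], over the integers. *)
Lemma square_bound (k m : nat) : 2 * (m * k.+1) <= m ^ 2 + m + k * k.+1.
Proof.
have [mk|km] := leqP m k.
  have [d ->] : exists d, k = m + d by exists (k - m); lia.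
  by have := leq0n (d * d); rewrite -mulnn; nia.
have [d ->] : exists d, m = k + d.+1 by exists (m - k.+1); lia.
  by have := leq0n (d * d); rewrite -mulnn; nia.
Qed.

(** * Distances and routes on the cycle *)

Lemma val_iter_ordS (N : nat) (u : 'I_N) j :
  iter j (@ordS N) u = (u + j) %% N :> nat.
Proof.
elim: j => [|j IH] /=; first by rewrite addn0 modn_small.
by rewrite IH -addn1 modnDml -addnA addn1.
Qed.

Lemma ltn_dist (N : nat) (u v : 'I_N) : dist u v < N.
Proof. by rewrite /dist ltn_mod (leq_trans _ (ltn_ord u)). Qed.

Lemma dist_inj (N : nat) (u : 'I_N) : injective (dist u).
Proof.
move=> v w; rewrite !distE => E; apply: val_inj => /=.
have := ltn_ord u; have := ltn_ord v; have := ltn_ord w.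
by move=> ? ? ?; move: E; case: leqP => ?; case: leqP => ?; lia.
Qed.

Lemma dist_injl (N : nat) (u : 'I_N) : injective (@dist N ^~ u).
Proof.
move=> v w; rewrite /= !distE => E; apply: val_inj => /=.
have := ltn_ord u; have := ltn_ord v; have := ltn_ord w.
by move=> ? ? ?; move: E; case: leqP => ?; case: leqP => ?; lia.
Qed.

Lemma distxx (N : nat) (u : 'I_N) : dist u u = 0.
Proof. by rewrite distE leqnn subnn. Qed.

Lemma dist_gt0 (N : nat) (u v : 'I_N) : (0 < dist u v) = (u != v).
Proof. by rewrite lt0n -(distxx u) (inj_eq (@dist_inj _ u)) eq_sym. Qed.

Lemma iter_dist (N : nat) (u v : 'I_N) : iter (dist u v) (@ordS N) u = v.
Proof.
apply: val_inj; rewrite /= val_iter_ordS distE.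
have := ltn_ord u; have := ltn_ord v; case: (leqP u v) => uv vN uN.
  by rewrite subnKC ?modn_small.
by rewrite (_ : u + _ = v + N) ?modnDr ?modn_small //; lia.
Qed.

Lemma dist_iter (N : nat) (u : 'I_N) j :
  j < N -> dist u (iter j (@ordS N) u) = j.
Proof.
move=> jN; rewrite distE val_iter_ordS; have := ltn_ord u => uN.
case: (ltnP (u + j) N) => h; first by rewrite modn_small ?leq_addr ?addKn.
rewrite -{1 2 3}(subnK h) modnDr modn_small; last lia.
by case: leqP => ?; lia.
Qed.

Lemma mem_route (N : nat) (u v w : 'I_N) :
  ((w, ordS w) \in route u v) = (dist u w < dist u v).
Proof.
apply/imsetP/idP => [[j]|uw]; first by rewrite inE => jd [-> _]; rewrite dist_iter.
by exists (Ordinal (ltn_dist u w)); rewrite ?inE //= iter_dist.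
Qed.

(** * Out-neighbourhoods and the size of an admissible digraph *)

Definition out (N : nat) (B : {set darc N}) (u : 'I_N) : {set 'I_N} :=
  [set v | (u, v) \in B].

Lemma mem_out (N : nat) (B : {set darc N}) (u v : 'I_N) :
  (v \in out B u) = ((u, v) \in B).
Proof. by rewrite inE. Qed.

Lemma sum_out (N : nat) (B : {set darc N}) (F : darc N -> nat) :
  \sum_(a in B) F a = \sum_(u in vertices B) \sum_(v in out B u) F (u, v).
Proof.
rewrite pair_big_dep /=; apply: eq_big => [[u v]|[u v] //].
rewrite /= !inE; apply/idP/andP => [uvB|[]//]; split=> //.
by apply/orP; left; apply/imsetP; exists (u, v).
Qed.

Lemma card_out (N : nat) (B : {set darc N}) :
  #|B| = \sum_(u in vertices B) #|out B u|.
Proof.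
by rewrite -sum1_card sum_out; apply: eq_bigr => u _; rewrite sum1_card.
Qed.

Lemma loadE (N : nat) (B : {set darc N}) (w : 'I_N) :
  load B (w, ordS w) = \sum_(a in B) (dist a.1 w < dist a.1 a.2).
Proof.
rewrite (sum_bool_card B (fun a => dist a.1 w < dist a.1 a.2)).
by apply: eq_card => -[u v]; rewrite !inE mem_route.
Qed.

Lemma admissible_card (C k N : nat) (B : {set darc N}) :
  C * 2 = k * k.+1 -> (forall a, a \in B -> a.1 != a.2) ->
  admissible C B -> #|B| <= k * #|vertices B|.
Proof.
move=> CE loopless /forall_inP adm.
have : \sum_(w in vertices B) load B (w, ordS w) <= #|vertices B| * C.
  by rewrite -sum_nat_const; apply: leq_sum => w _; apply: adm; apply: imset_f.
under eq_bigr do rewrite loadE.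
rewrite exchange_big sum_out /= => le_pC.
(* As [C * 2 = k * k.+1], this is the claim multiplied by [2 * k.+1]; in this form it splits into
   one instance of [square_bound] per vertex, with [m] its out-degree. *)
suff : 2 * (#|B| * k.+1) <=
    2 * (#|vertices B| * C) + #|vertices B| * (k * k.+1).
  move=> le; rewrite -(leq_pmul2r (ltn0Sn k)) -(leq_pmul2l (ltn0Sn 1)).
  by move: #|B| #|vertices B| le => b p; have := congr1 (muln p) CE; nia.
apply: leq_trans (leq_add (leq_mul (leqnn 2) le_pC) (leqnn _)).
rewrite card_out big_distrl !big_distrr /= -sum_nat_const -big_split /=.
apply: leq_sum => u uV; apply: leq_trans (square_bound _ _) _.
rewrite leq_add2r -(@sum_card_lt _ _ (dist u)); last by move=> v w _ _ /dist_inj.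
rewrite -addnA addnn -muln2 [_ * 2]mulnC -mulnDr leq_mul2l /=.
rewrite -sum1_card -big_split /=; apply: leq_sum => v uv.
rewrite (sum_bool_card _ (fun w => dist u w < dist u v)).
rewrite inE in uv; rewrite addnC.
(* Besides the nearer out-neighbours, the route to [v] meets [u] itself, at distance 0; this raises
   the count from the rank of [v] to its rank plus one. *)
have uO : u \notin [set w in out B u | dist u w < dist u v].
  by rewrite !inE; apply: contraTN isT => /andP[/loopless]; rewrite eqxx.
have := cardsU1 u [set w in out B u | dist u w < dist u v].
rewrite uO => <-; apply/subset_leq_card/subsetP => w.
rewrite !inE => /predU1P[->|/andP[uw ->]].
  rewrite distxx dist_gt0 (loopless (u, v)) // andbT.
  by move: uV; rewrite inE.
by rewrite andbT; apply/orP; right; apply/imsetP; exists (u, w).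
Qed.

(** * A convexity criterion for admissibility *)

(** In increasing order of [f], the successive positive values of [d] are at most k, k - 1, and so
    on. If there are m of them, their sum is at most mk - m(m - 1)/2, and [square_bound] applies. *)
Lemma sum_load_bound (I : finType) (A : {set I}) (f d : I -> nat) (k : nat) :
  {in A &, injective f} ->
  (forall x, x \in A -> 0 < d x -> d x + #|[set y in A | f y < f x]| <= k) ->
  2 * (\sum_(x in A) d x) <= k * k.+1.
Proof.
move=> f_inj bound; pose M := [set x in A | 0 < d x].
have -> : \sum_(x in A) d x = \sum_(x in M) d x.
  rewrite big_mkcond [RHS]big_mkcond; apply: eq_bigr => x _.
  by rewrite inE; case: (x \in A); case: (d x).
have fM : {in M &, injective f}.
  by move=> x y; rewrite !inE => /andP[xA _] /andP[yA _]; apply: f_inj.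
have := sum_card_lt fM; have := square_bound k #|M|.
suff : \sum_(x in M) d x + \sum_(x in M) #|[set y in M | f y < f x]| <= #|M| * k.
  by nia.
rewrite -sum_nat_const -big_split /=; apply: leq_sum => x.
rewrite inE => /andP[xA dx]; apply: leq_trans (bound x xA dx).
rewrite leq_add2l; apply/subset_leq_card/subsetP => y.
by rewrite !inE => /andP[/andP[-> _] ->].
Qed.

Lemma dist_between (N : nat) (u w y : 'I_N) :
  dist y w <= dist u w -> dist u y + dist y w = dist u w.
Proof.
rewrite !distE.
have := ltn_ord u; have := ltn_ord w; have := ltn_ord y.
by case: (leqP u w); case: (leqP y w); case: (leqP u y); lia.
Qed.

(** Fix the arc leaving [w]. If an arc from [u] crosses it, the vertices strictly nearer to [w] than
    [u] lie between [u] and [w], so by convexity they are out-neighbours of [u]. Together with the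
    heads beyond [w] they number at most k, as [sum_load_bound] requires. *)
Lemma convex_admissible (C k N : nat) (B : {set darc N}) :
  C * 2 = k * k.+1 -> (forall u, #|out B u| <= k) ->
  (forall u v w, (u, v) \in B -> w \in vertices B -> u != w ->
     dist u w < dist u v -> (u, w) \in B) ->
  admissible C B.
Proof.
move=> CE deg convex; apply/forall_inP => _ /imsetP[w _ ->].
rewrite -(leq_pmul2l (ltn0Sn 1)) [2 * C]mulnC CE loadE sum_out.
apply: (sum_load_bound (f := @dist N ^~ w)) => [u u' _ _ /dist_injl //|u uV].
rewrite (sum_bool_card _ (fun v => dist u w < dist u v)).
case/card_gt0P => v; rewrite !inE => /andP[uvB uwv].
apply: leq_trans (deg u); set A := [set _ in _ | _]; set A' := [set _ in _ | _].
rewrite -(cardsID A' (out B u)) addnC.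
apply: leq_add; apply/subset_leq_card/subsetP => y.
  rewrite inE => /andP[yV ywu]; have uy := dist_between (ltnW ywu).
  have u_y : u != y by rewrite -dist_gt0; lia.
  rewrite in_setI; have yo : (u, y) \in B by apply: convex uvB yV u_y _; lia.
  by rewrite !in_set yo -in_setU yV ywu.
rewrite !in_set => /andP[-> uwy]; rewrite andbT; apply/negP => /andP[_ ywu].
by have := dist_between (ltnW ywu); lia.
Qed.

(** * Arc counts and cost *)

Lemma card_tournament (N : nat) (T : {set darc N}) :
  tournament T -> 2 * #|T| = N * (N - 1).
Proof.
case/andP => /forallP loopless /forallP arcs.
have TE : #|T| = \sum_u \sum_v ((u, v) \in T).
  rewrite -sum1_card big_mkcond /= pair_bigA; apply: eq_bigr => -[u v] _ /=.
  by case: (_ \in T).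
rewrite mul2n -addnn {2}TE exchange_big TE /= -big_split /=.
rewrite -[in RHS](card_ord N) -sum_nat_const; apply: eq_bigr => u _.
rewrite -big_split /= (bigD1 u) //= (negbTE (loopless u)) !add0n.
rewrite subn1 -(cardC1 u) -sum1_card.
apply: eq_big => [v|v]; rewrite ?inE // eq_sym => uv.
by have := forallP (arcs u) v; rewrite uv; case: (_ \in T); case: (_ \in T).
Qed.

Lemma regular_cost (k N : nat) (T : {set darc N}) (P : {set {set darc N}}) :
  partition P T ->
  (forall B u, B \in P -> u \in vertices B -> #|out B u| = k) ->
  k * cost P = #|T|.
Proof.
move=> partP deg; rewrite (card_partition partP) /cost big_distrr /=.
apply: eq_bigr => B BP; rewrite card_out mulnC -sum_nat_const.
by apply: eq_bigr => u uB; rewrite (deg B).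
Qed.

Lemma cost_lower_bound (C k N : nat) (T : {set darc N})
    (P : {set {set darc N}}) :
  C * 2 = k * k.+1 -> tournament T -> valid_partition C T P ->
  #|T| <= k * cost P.
Proof.
move=> CE /andP[/forallP loopless _] /andP[partP /forall_inP adm].
rewrite (card_partition partP) /cost big_distrr /=; apply: leq_sum => B BP.
apply: admissible_card CE _ (adm B BP) => -[u v] uvB /=.
apply: contraNneq (loopless u) => {2}->; rewrite -(cover_partition partP).
by apply/bigcupP; exists B.
Qed.

(** * Doubling the points of a design *)

Lemma mem_default_tournament (N n : nat) (u v : 'I_N) :
  N = 2 * n + 1 ->
  ((u, v) \in default_tournament N) = (u != v) && (dist u v <= n).
Proof.
move=> NE; rewrite inE /=; case: (u != v) => //=.
move: (dist u v) => d; case: eqP => [|_]; first lia.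
by rewrite orbF; lia.
Qed.

(* The points of a design, numbered by [r : V -> 'I_n], are doubled: [x] labels
   the antipodal vertices [r x] and [r x + n] of the cycle of length [2 n + 1],
   and the remaining vertex [2 n] plays the role of a point at infinity. *)
Definition pt (V : finType) (n : nat) (r : V -> 'I_n) (N : nat) (u : 'I_N) :
    option V :=
  [pick x | (u == r x :> nat) || (u == r x + n :> nat)].

Lemma ptE (V : finType) (n : nat) (r : V -> 'I_n) (N : nat) (u : 'I_N) (x : V) :
  injective r -> u = r x :> nat \/ u = r x + n :> nat -> pt r u = Some x.
Proof.
move=> r_inj ux; rewrite /pt; case: pickP => [y uy|/(_ x)]; last first.
  by case: ux => ->; rewrite eqxx ?orbT.
congr Some; apply/r_inj/val_inj => /=.
have := ltn_ord (r x); have := ltn_ord (r y).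
by case/orP: uy => /eqP; case: ux; lia.
Qed.

Lemma ptP (V : finType) (n : nat) (r : V -> 'I_n) (N : nat) (u : 'I_N) :
  bijective r -> N = 2 * n + 1 ->
  match pt r u with
  | Some x => u = r x :> nat \/ u = r x + n :> nat
  | None => u = 2 * n :> nat
  end.
Proof.
move=> r_bij NE; have r_inj := bij_inj r_bij; have [g _ gK] := r_bij.
case E: (pt r u) => [x|].
  by move: E; rewrite /pt; case: pickP => // y /orP[]/eqP uy [<-]; [left|right].
have uN := ltn_ord u; case: (ltnP u n) => [un|nu].
  by rewrite (ptE (x := g (Ordinal un))) ?gK // in E; left.
case: (ltnP (u - n) n) => [un|]; last by lia.
rewrite (ptE (x := g (Ordinal un))) ?gK // in E; right => /=.
by rewrite subnK.
Qed.

(* Every point has exactly one lift among the out-neighbours of [u], except that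
   infinity may take the place of the other lift of the point of [u].  Hence
   [phi r u] maps the out-neighbours of [u] bijectively onto the points. *)
Definition phi (V : finType) (n : nat) (r : V -> 'I_n) (N : nat)
    (u v : 'I_N) : option V :=
  if pt r v is Some y then Some y else pt r u.

(* The out-neighbour that [phi] maps to a point numbered [j], see [phiP]. *)
Definition lift_nat (n u j : nat) : nat :=
  if u < j then j else
  if u < j + n then j + n else
  if u == j + n then 2 * n else j.

(** The lifts of [y] cut the cycle into pieces of lengths n and n + 1, so exactly one of the n
    vertices after [u] is a lift of [y], except when [u] is [r y + n]: the other lift is then at
    distance n + 1, and infinity, at distance n - [r y], takes its place. *)
Lemma phiP (V : finType) (n : nat) (r : V -> 'I_n) (N : nat) (u v : 'I_N)
    (y : V) :
  bijective r -> N = 2 * n + 1 ->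
  ((u, v) \in default_tournament N /\ phi r u v = Some y) <->
  v = lift_nat n u (r y) :> nat.
Proof.
move=> r_bij NE; have r_inj := bij_inj r_bij.
rewrite (mem_default_tournament _ _ NE) /lift_nat -val_eqE distE /phi /=.
have uN := ltn_ord u; have vN := ltn_ord v; have yn := ltn_ord (r y).
split=> [[/andP[uv d]]|vE].
  have := ptP v r_bij NE; case: (pt r v) => [z|] hv => [[zy]|E].
    by move: hv d; rewrite zy; case: (leqP u v); do ?case: ifP; lia.
  have := ptP u r_bij NE; rewrite E.
  by move: d; case: (leqP u v); do ?case: ifP; lia.
split; first by move: vE; case: (leqP u v); do ?case: ifP; lia.
have [v2n|v2n] := eqVneq (v : nat) (2 * n).
  have := ptP v r_bij NE; case: (pt r v) => [z|] hv.
    by have := ltn_ord (r z); move: hv; lia.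
  by apply: ptE => //; move: vE; do ?case: ifP; lia.
by rewrite (ptE (x := y)) //; move: vE; do ?case: ifP; lia.
Qed.

Lemma phi_None (V : finType) (n : nat) (r : V -> 'I_n) (N : nat) (u v : 'I_N) :
  bijective r -> N = 2 * n + 1 -> u != v -> phi r u v <> None.
Proof.
move=> r_bij NE uv; rewrite /phi; have := ptP v r_bij NE.
case: (pt r v) => // v2n; have := ptP u r_bij NE; case: (pt r u) => // u2n _.
by case/eqP: uv; apply: val_inj; rewrite /= u2n v2n.
Qed.

Lemma pt_antipodal (V : finType) (n : nat) (r : V -> 'I_n) (N : nat)
    (u w : 'I_N) (x : V) :
  bijective r -> N = 2 * n + 1 -> u != w -> pt r u = Some x -> pt r w = Some x ->
  n <= dist u w.
Proof.
move=> r_bij NE; rewrite -val_eqE distE /= => uw ux wx.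
have := ptP u r_bij NE; have := ptP w r_bij NE; rewrite ux wx.
by case: (leqP u w); lia.
Qed.

Definition mem_pt (V : finType) (n : nat) (r : V -> 'I_n) (Q : {set V})
    (c : bool) (N : nat) (u : 'I_N) : bool :=
  if pt r u is Some x then x \in Q else c.

(* For [c = false], the blow-up of the clique on [Q]: the two lifts of a point
   are not joined.  For [c = true], the complete graph on infinity and the
   lifts of [Q]. *)
Definition blowup (V : finType) (n : nat) (r : V -> 'I_n) (Q : {set V})
    (c : bool) (N : nat) : {set darc N} :=
  [set a in default_tournament N |
    [&& mem_pt r Q c a.1, mem_pt r Q c a.2 & c || (pt r a.1 != pt r a.2)]].

Lemma mem_blowup (V : finType) (n : nat) (r : V -> 'I_n) (Q : {set V})
    (c : bool) (N : nat) (u v : 'I_N) :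
  ((u, v) \in blowup r Q c N) =
  [&& (u, v) \in default_tournament N, mem_pt r Q c u, mem_pt r Q c v &
      c || (pt r u != pt r v)].
Proof. by rewrite in_set. Qed.

(** On the out-neighbours of [u], [phi r u] is injective; its image is all of [Q] when [c] holds,
    and [Q] without the point of [u] otherwise. *)
Lemma out_blowup (V : finType) (n : nat) (r : V -> 'I_n) (Q : {set V})
    (c : bool) (N : nat) (u : 'I_N) :
  bijective r -> N = 2 * n + 1 -> mem_pt r Q c u ->
  #|out (blowup r Q c N) u|.+1 = #|Q| + c.
Proof.
move=> r_bij NE Qu.
rewrite -(card_in_imset (f := phi r u)); last first.
  move=> v w; rewrite !mem_out !mem_blowup => /andP[uv _] /andP[uw _].
  case E: (phi r u v) => [y|] /esym Ew.
    apply: val_inj; transitivity (lift_nat n u (r y)).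
      exact: ((phiP u v y r_bij NE).1 (conj uv E)).
    exact/esym/((phiP u w y r_bij NE).1 (conj uw Ew)).
  move: uv; rewrite (mem_default_tournament _ _ NE) => /andP[uv _].
  by case: (phi_None r_bij NE uv).
set Q' := [set y in Q | c || (pt r u != Some y)].
have -> : phi r u @: out (blowup r Q c N) u = [set Some y | y in Q'].
  apply/setP => z; apply/imsetP/imsetP => [[v]|[y]].
    rewrite mem_out mem_blowup => /and4P[uv _ Qv uv'] ->.
    move: uv; rewrite (mem_default_tournament _ _ NE) => /andP[uv _].
    have := phi_None r_bij NE uv; move: Qu Qv uv'; rewrite /mem_pt /phi.
    case: (pt r v) => [y|] => [_ yQ cu _|]; first by exists y; rewrite // inE yQ.
    by case: (pt r u) => [x|] // xQ c1 _ _; exists x; rewrite // inE xQ c1.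
  rewrite inE => /andP[yQ cu] ->.
  have tN : lift_nat n u (r y) < N.
    by have := ltn_ord (r y); rewrite /lift_nat; do ?case: ifP; lia.
  have [uv uvy] := (phiP u (Ordinal tN) y r_bij NE).2 erefl.
  exists (Ordinal tN) => //; rewrite mem_out mem_blowup uv Qu /=.
  move: uvy cu; rewrite /phi /mem_pt; case: (pt r _) => [z'|] => [[->]|-> //].
    by rewrite yQ.
  by rewrite eqxx orbF => ->.
rewrite (card_imset _ Some_inj) /Q' {Q'}; case: c Qu => [_|].
  by rewrite addn1; congr _.+1; apply: eq_card => y; rewrite !inE andbT.
rewrite /mem_pt addn0; case: (pt r u) => // x xQ; rewrite [in RHS](cardsD1 x) xQ.
by congr _.+1; apply: eq_card => y; rewrite !inE andbC eq_sym.
Qed.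

Lemma mem_pt_vertices (V : finType) (n : nat) (r : V -> 'I_n) (Q : {set V})
    (c : bool) (N : nat) (u : 'I_N) :
  u \in vertices (blowup r Q c N) -> mem_pt r Q c u.
Proof.
by rewrite inE => /orP[]/imsetP[a]; rewrite inE => /and4P[_ ? ? _] ->.
Qed.

Lemma blowup_admissible (V : finType) (n : nat) (r : V -> 'I_n) (Q : {set V})
    (c : bool) (C k N : nat) :
  bijective r -> N = 2 * n + 1 -> C * 2 = k * k.+1 -> #|Q| + c = k.+1 ->
  admissible C (blowup r Q c N).
Proof.
move=> r_bij NE CE Qk; apply: (convex_admissible CE) => [u|u v w].
  have [|/set0Pn[v]] := eqVneq (out (blowup r Q c N) u) set0.
    by move->; rewrite cards0.
  rewrite mem_out mem_blowup => /and4P[_ Qu _ _].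
  by rewrite -ltnS -Qk (out_blowup r_bij NE Qu).
rewrite !mem_blowup => /and4P[uv Qu _ _] /mem_pt_vertices Qw uw uwv.
move: uv; rewrite !(mem_default_tournament _ _ NE) => /andP[_ uv].
rewrite uw Qu Qw (leq_trans (ltnW uwv)) //=; case: c Qu {Qk Qw} => //= Qu.
(* Only the other lift of the point of [u] could break convexity, but it is at distance at least n,
   whereas [w] comes strictly before [v], which is at distance at most n. *)
apply/eqP => E; move: Qu; rewrite /mem_pt; case Eu: (pt r u) => [x|] // _.
by have := pt_antipodal r_bij NE uw Eu (etrans (esym E) Eu); lia.
Qed.

(** * From the design to the partition *)

Lemma complete_multipartiteE (k q : nat) (x y : 'I_q * 'I_k) :
  ([set x; y] \in complete_multipartite k q) = (x.1 != y.1).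
Proof.
rewrite inE; apply/existsP/idP => [[x' /existsP[y' /andP[xy' /eqP E]]]|xy].
  have : x' \in [set x; y] by rewrite E set21.
  have : y' \in [set x; y] by rewrite E set22.
  rewrite !inE => /orP[]/eqP Ey /orP[]/eqP Ex; move: xy'; rewrite Ex Ey ?eqxx //.
  by rewrite eq_sym.
by exists x; apply/existsP; exists y; rewrite xy eqxx.
Qed.

Lemma mem_complete_graph (V : finType) (S : {set V}) (x y : V) :
  ([set x; y] \in complete_graph S) = [&& x \in S, y \in S & x != y].
Proof. by rewrite inE subUset !sub1set cards2 andbA; case: (x != y). Qed.

Definition part (k q : nat) (i : 'I_q) : {set 'I_q * 'I_k} :=
  [set x | x.1 == i].

Lemma card_part (k q : nat) (i : 'I_q) : #|part k i| = k.
Proof.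
have -> : part k i = setX [set i] setT.
  by apply/setP => -[x y]; rewrite !inE andbT.
by rewrite cardsX cards1 mul1n cardsT card_ord.
Qed.

(** The fibres over the arcs of the tournament are the members of the partition: [inl] is for blocks
    of the design, each represented by its edge set, and [inr] for groups. [inl set0] is a default,
    since the ends of an arc are not both infinity. *)
Definition line (k q n : nat) (r : 'I_q * 'I_k -> 'I_n)
    (D : {set {set {set 'I_q * 'I_k}}}) (N : nat) (a : darc N) :
    {set {set 'I_q * 'I_k}} + 'I_q :=
  match pt r a.1, pt r a.2 with
  | Some x, Some y => if x.1 == y.1 then inr x.1 else inl (pblock D [set x; y])
  | Some x, None | None, Some x => inr x.1
  | None, None => inl set0
  end.

Lemma line_part (k q n : nat) (r : 'I_q * 'I_k -> 'I_n)
    (D : {set {set {set 'I_q * 'I_k}}}) (N : nat) (i : 'I_q) :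
  bijective r -> N = 2 * n + 1 ->
  [set a in default_tournament N | line r D a == inr i] =
  blowup r (part k i) true N.
Proof.
move=> r_bij NE; apply/setP => -[u v]; rewrite in_set mem_blowup.
rewrite (mem_default_tournament _ _ NE); case: eqVneq => [//|uv].
have := phi_None r_bij NE uv; rewrite /phi /line /mem_pt /= andbT.
case: (pt r u) (pt r v) => [x|] [y|] // _; rewrite ?inE ?andbT //.
congr (_ && _); case: ifP => [/eqP->|xy]; first by rewrite andbb.
by apply/esym/andP => -[/eqP xi /eqP yi]; rewrite xi yi eqxx in xy.
Qed.

Lemma line_block (k q n : nat) (r : 'I_q * 'I_k -> 'I_n)
    (X : {set {set 'I_q * 'I_k}}) (N : nat) (S : {set 'I_q * 'I_k}) :
  bijective r -> N = 2 * n + 1 ->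
  partition [set complete_graph S | S in X] (complete_multipartite k q) ->
  S \in X ->
  [set a in default_tournament N |
     line r [set complete_graph S | S in X] a == inl (complete_graph S)] =
  blowup r S false N.
Proof.
set D := [set _ | _ in X] => r_bij NE /and3P[/eqP covD trivD _] SX.
have SD : complete_graph S \in D by apply: imset_f.
apply/setP => -[u v]; rewrite in_set mem_blowup.
rewrite (mem_default_tournament _ _ NE); case: eqVneq => [//|uv].
have := phi_None r_bij NE uv; rewrite /phi /line /mem_pt /=.
case: (pt r u) (pt r v) => [x|] [y|] // _; rewrite ?andbF //; congr (_ && _).
rewrite (inj_eq Some_inj) -mem_complete_graph.
have E : ([set x; y] \in cover D) = (x.1 != y.1).
  by rewrite covD complete_multipartiteE.
case: ifP E => xy E.
  (* Two points of one group form no edge of the multipartite graph, so no block contains both. *)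
  by apply/esym; apply: contraFF E => xyS; apply/bigcupP; exists (complete_graph S).
apply/eqP/idP => [[<-]|xyS]; first by rewrite mem_pblock E.
by rewrite (def_pblock trivD SD xyS).
Qed.

Lemma gdd_partition (k q C N : nat) :
  clique_decomposable k.+1 (complete_multipartite k q) ->
  N = 2 * k * q + 1 -> C * 2 = k * k.+1 ->
  exists2 P : {set {set darc N}}, valid_partition C (default_tournament N) P &
    k * cost P = #|default_tournament N|.
Proof.
move=> [X cardX partX] NE CE; pose V := ('I_q * 'I_k)%type.
have [r r_bij] : exists r : V -> 'I_(k * q), bijective r.
  have cV : #|{: V}| = k * q by rewrite card_prod !card_ord mulnC.
  exists (fun x => cast_ord cV (enum_rank x)).
  exact: bij_comp (Bijective (cast_ordK cV) (cast_ordKV cV)) (@enum_rank_bij V).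
have NE' : N = 2 * (k * q) + 1 by rewrite NE mulnA.
set D := [set _ | _ in X] in partX.
pose P := preim_partition (line r D (N := N)) (default_tournament N).
have PP : partition P (default_tournament N) := preim_partitionP _ _.
(* [Q] is either a group of k points, joined by infinity, or a block of k + 1 points. *)
have blocks B : B \in P ->
    exists Q c, B = blowup r Q c N /\ #|Q| + c = k.+1.
  case/imsetP => -[u v]; rewrite (mem_default_tournament _ _ NE') => /andP[uv _].
  have : line r D (u, v) = line r D (u, v) by [].
  rewrite {1}/line /=; have := phi_None r_bij NE' uv; rewrite /phi.
  have inr_line i : inr i = line r D (u, v) ->
      B = [set y in default_tournament N | line r D (u, v) == line r D y] ->
      exists Q c, B = blowup r Q c N /\ #|Q| + c = k.+1.
    move=> <- ->; exists (part k i), true; rewrite card_part addn1; split=> //.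
    rewrite -(line_part D i r_bij NE'); apply/setP => a.
    by rewrite !in_set [inr i == _]eq_sym.
  case: (pt r u) (pt r v) => [x|] [y|] // _; try exact: inr_line.
  case: ifP => [_|xy]; first exact: inr_line.
  have xyD : [set x; y] \in cover D.
    by rewrite (cover_partition partX) complete_multipartiteE xy.
  have /imsetP[S SX SE] := pblock_mem xyD; rewrite SE => <- ->.
  exists S, false; rewrite addn0 cardX //; split=> //.
  rewrite -(line_block r_bij NE' partX SX); apply/setP => a.
  by rewrite !in_set [inl _ == _]eq_sym.
exists P; last first.
  apply: (regular_cost PP) => B u /blocks[Q [c [-> Qk]]] /mem_pt_vertices Qu.
  by apply/eqP; rewrite -eqSS -Qk (out_blowup r_bij NE' Qu).
rewrite /valid_partition PP; apply/forall_inP => B /blocks[Q [c [-> Qk]]].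
exact: (blowup_admissible r_bij NE' CE Qk).
Qed.

(* Both divisions are exact: k and k + 1 have opposite parities, and 2 * k
   divides N - 1 = 2 * k * q. *)
Theorem theorem5 (k q N C : nat) (hk : 1 <= k) (hq : 1 <= q)
    (hGDD : clique_decomposable k.+1 (complete_multipartite k q))
    (hN : N = 2 * k * q + 1) (hC : C = (k * (k + 1)) %/ 2) :
  (forall T : {set darc N}, request_tournament T ->
     exists2 P : {set {set darc N}}, valid_partition C T P &
       cost P = (N * (N - 1)) %/ (2 * k)) /\
  min_cost C N = (N * (N - 1)) %/ (2 * k).
Proof.
have CE : C * 2 = k * k.+1.
  by rewrite hC addn1 divnK // dvdn2 oddM oddS andbN.
have C0 : 0 < C by rewrite -(ltn_pmul2r (ltn0Sn 1)) CE muln_gt0 hk.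
have oN : odd N by rewrite hN addn1 oddS -mulnA oddM.
have N1 : N - 1 = 2 * k * q by rewrite hN addnK.
have costE : (N * (N - 1)) %/ (2 * k) = N * q.
  by rewrite N1 mulnCA mulKn // muln_gt0.
have cardT T : @request_tournament N T -> #|T| = k * (N * q).
  case/andP => /card_tournament; rewrite N1 => TE _.
  by apply/eqP; rewrite -(eqn_pmul2l (ltn0Sn 1)) TE; apply/eqP; lia.
have [P vP cP] := gdd_partition hGDD hN CE.
have {}cP : cost P = N * q.
  by apply/eqP; rewrite -(eqn_pmul2l hk) cP cardT ?default_tournamentP.
rewrite costE; split=> [T rT|].
  (* As [N] is odd, the request tournament is unique, and the partition already built serves every
     [T]. *)
  by exists P; rewrite // (request_tournament_uniq oN rT (default_tournamentP N)).
have [[T [P' [rT vP' minE]]] le] := min_costP N C0.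
apply/eqP; rewrite eqn_leq; apply/andP; split.
  by rewrite -cP; apply: le (default_tournamentP N) vP.
rewrite -minE -(leq_pmul2l hk) -(cardT T rT); apply: cost_lower_bound CE _ vP'.
by case/andP: rT.
Qed.
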